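(* Consider $F^\star:=\min_{x\in\mathbb{R}^p}\{F(x):=f(x)+\psi(x)\ \text{ s.t. }\ Kx=b\}$, where $f,\psi:\mathbb{R}^p\to\mathbb{R}\cup\{+\infty\}$ are proper, closed and convex, $K:\mathbb{R}^p\to\mathbb{R}^n$ is linear and $b\in\mathbb{R}^n$. Assume the solution set is nonempty, $\mathrm{ri}(\mathrm{dom}(f)\cap\mathrm{dom}(\psi))\cap\{x: Kx=b\}\neq\emptyset$, and $\psi$ is $L_\psi$-smooth. Let $(x^\star,y^\star)$ be a pair of primal-dual optimal solutions, and let $\{(x^k,\bar y^k)\}$ be generated by the scheme in the context with parameters $\rho_0>0$, $\gamma\in(0,1)$, $c\ge1$. (i) If $c:=1$, then for all $k\ge1$, $$|F(x^k)-F^\star|\le\frac{R_0^2}{2k}\quad\text{and}\quad\|Kx^k-b\|\le\frac{R_0^2}{2k},$$ where $R_0^2:=\frac{\rho_0\|K\|^2+\gamma L_\psi}{\gamma}\|x^0-x^\star\|^2+\frac{1}{(1-\gamma)\rho_0}(2\|y^\star\|+\|y^0\|+1)^2$. If, in addition, $\mathrm{dom}(F)$ is bounded, then for all $k\ge1$, $$G(\bar y^k)-G^\star\le\frac{1}{2k}\left[\frac{(\rho_0\|K\|^2+\gamma L_\psi)\mathcal{D}_F^2}{\gamma}+\frac{\|y^0-y^\star\|^2}{(1-\gamma)\rho_0}\right],$$ where $\mathcal{D}_F:=\sup\{\|x-x^0\| : x\in\mathrm{dom}(F)\}<+\infty$. (ii) If $c>1$, then $|F(x^k)-F^\star|=O(1/k)$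 and $\|Kx^k-b\|=O(1/k)$ still hold, and $$\liminf_{k\to\infty}\;k\sqrt{\log k}\,\left[|F(x^k)-F^\star|+\|Kx^k-b\|\right]=0.$$
   Context: $\mathrm{ri}$ is the relative interior; $\|K\|$ is the operator norm; $\mathrm{prox}_h(x):=\arg\min_y\{h(y)+\frac12\|y-x\|^2\}$. $\psi$ is $L_\psi$-smooth ($L_\psi\in[0,+\infty)$) if it is differentiable on its domain with $\|\nabla\psi(x)-\nabla\psi(y)\|\le L_\psi\|x-y\|$ for all $x,y\in\mathrm{dom}(\psi)$. The dual problem is $G^\star:=\min_{y\in\mathbb{R}^n}G(y)$, where $G(y):=\sup_x\{\langle -K^\top y,x\rangle-f(x)-\psi(x)\}+\langle b,y\rangle$; $y^\star$ is an optimal solution of it. Here $\mathrm{dom}(F)$ is the domain of $f+\psi$. Scheme. Inputs: $x^0\in\mathbb{R}^p$, $y^0\in\mathbb{R}^n$, $\rho_0>0$, $c\ge1$, $\gamma\in(0,1)$. Set $\hat x^0:=x^0$, $\tilde y^0:=\bar y^0:=y^0$. For $k\ge 0$ let $\tau_k:=\frac{c}{k+c}$, $\rho_k:=\frac{\rho_0}{\tau_k}$, $\eta_k:=(1-\gamma)\rho_k$, $\beta_k:=\frac{\gamma}{\|K\|^2\rho_k+\gamma L_\psi}$, and update $$\begin{aligned} y^{k+1}&:=\tilde y^k+\rho_k(K\hat x^k-b),\\ x^{k+1}&:=\mathrm{prox}_{\beta_kf}\left(\hat x^k-\beta_k[K^\top y^{k+1}+\nabla\psi(\hat x^k)]\right),\\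 \hat x^{k+1}&:=x^{k+1}+\tfrac{\tau_{k+1}(1-\tau_k)}{\tau_k}(x^{k+1}-x^k),\\ \tilde y^{k+1}&:=\tilde y^k+\eta_k\left[K(x^{k+1}-(1-\tau_k)x^k)-\tau_kb\right],\\ \bar y^{k+1}&:=(1-\tau_k)\bar y^k+\tau_ky^{k+1}. \end{aligned}$$ *)

(* Defs.v *)
From HB Require Import structures.
From mathcomp Require Import all_boot all_order all_algebra.
From mathcomp Require Import all_classical all_reals all_analysis.

Set Implicit Arguments.
Unset Strict Implicit.
Unset Printing Implicit Defensive.

Import Order.TTheory GRing.Theory Num.Theory.
Import numFieldNormedType.Exports.

Local Open Scope classical_set_scope.
Local Open Scope ring_scope.

Section Euclidean.
Variable R : realType.

Definition dot (m : nat) (u v : 'cV[R]_m) : R := \sum_i u i 0 * v i 0.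

(* The library norm on matrices is the max norm, hence this definition. *)
Definition enorm (m : nat) (u : 'cV[R]_m) : R := Num.sqrt (dot u u).

Definition opnorm (n p : nat) (K : 'M[R]_(n, p)) : R :=
  sup [set enorm (K *m x) | x in [set x : 'cV[R]_p | enorm x <= 1]].

Definition ebounded (m : nat) (A : set 'cV[R]_m) : Prop :=
  exists M : R, forall x, A x -> enorm x <= M.

Definition affine_hull (m : nat) (A : set 'cV[R]_m) : set 'cV[R]_m :=
  [set z | exists (q : nat) (a : 'I_q -> R) (v : 'I_q -> 'cV[R]_m),
     [/\ forall i, A (v i), \sum_i a i = 1 & z = \sum_i a i *: v i]].

Definition ri (m : nat) (A : set 'cV[R]_m) : set 'cV[R]_m :=
  [set x | A x /\ exists2 e : R, 0 < e &
     forall z, affine_hull A z -> enorm (z - x) < e -> A z].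

End Euclidean.

Section ConvexFunctions.
Variables (R : realType) (m : nat).
Implicit Types (h : 'cV[R]_m -> \bar R) (x z : 'cV[R]_m).

Definition effdom h : set 'cV[R]_m := [set x | (h x < +oo)%E].

Definition proper_fun h : Prop := (forall x, h x != -oo%E) /\ effdom h !=set0.

Definition closed_fun h : Prop :=
  closed [set xt : 'cV[R]_m * R | (h xt.1 <= xt.2%:E)%E].

Definition convex_fun h : Prop :=
  forall x z (t : R), 0 <= t <= 1 ->
    (h (t *: x + (1 - t) *: z)%R <= t%:E * h x + (1 - t)%:E * h z)%E.

(* Frechet differentiability at x of an extended-real function, which requires
   it to be finite around x. *)
Definition differentiable_ext h x : Prop :=
  (\forall z \near x, h z \is a fin_num) /\ differentiable (fine \o h) x.

Definition gradient h x : 'cV[R]_m :=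
  \col_i 'd (fine \o h) x (delta_mx i 0).

Definition smooth (L : R) h : Prop :=
  [/\ 0 <= L,
      forall x, effdom h x -> differentiable_ext h x &
      forall x z, effdom h x -> effdom h z ->
        enorm (gradient h x - gradient h z) <= L * enorm (x - z)].

(* z = prox_h(x); for proper closed convex h there is exactly one such z. *)
Definition is_prox h x z : Prop :=
  forall u, (h z + (2^-1 * enorm (z - x) ^+ 2)%:E
             <= h u + (2^-1 * enorm (u - x) ^+ 2)%:E)%E.

End ConvexFunctions.

Section Problem.
Variables (R : realType) (p n : nat).
Variables (f psi : 'cV[R]_p -> \bar R) (K : 'M[R]_(n, p)) (b : 'cV[R]_n).

Definition objF (x : 'cV[R]_p) : \bar R := (f x + psi x)%E.

Definition feasible : set 'cV[R]_p := [set x | K *m x = b].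

Definition Fstar : \bar R := ereal_inf [set objF x | x in feasible].

Definition primal_sol : set 'cV[R]_p := [set x | feasible x /\ objF x = Fstar].

Definition dualG (y : 'cV[R]_n) : \bar R :=
  (ereal_sup [set (dot (- (K^T *m y)) x)%:E - f x - psi x | x in setT]
   + (dot b y)%:E)%E.

Definition Gstar : \bar R := ereal_inf (range dualG).

Definition dual_sol : set 'cV[R]_n := [set y | dualG y = Gstar].

End Problem.

Section Scheme.
Variables (R : realType) (p n : nat).
Variables (f psi : 'cV[R]_p -> \bar R) (K : 'M[R]_(n, p)) (b : 'cV[R]_n).
Variables (L rho0 c gamma : R).

Definition tau (k : nat) : R := c / (k%:R + c).
Definition rho (k : nat) : R := rho0 / tau k.
Definition eta (k : nat) : R := (1 - gamma) * rho k.
Definition beta (k : nat) : R := gamma / (opnorm K ^+ 2 * rho k + gamma * L).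

Record scheme (x0 : 'cV[R]_p) (y0 : 'cV[R]_n)
    (x xhat : nat -> 'cV[R]_p) (y ytil ybar : nat -> 'cV[R]_n) : Prop := {
  scheme_x0 : x 0%N = x0;
  scheme_xhat0 : xhat 0%N = x0;
  scheme_ytil0 : ytil 0%N = y0;
  scheme_ybar0 : ybar 0%N = y0;
  scheme_y : forall k, y k.+1 = ytil k + rho k *: (K *m xhat k - b);
  scheme_x : forall k,
    is_prox (fun u => (beta k)%:E * f u)%E
      (xhat k - beta k *: (K^T *m y k.+1 + gradient psi (xhat k)))
      (x k.+1);
  scheme_xhat : forall k,
    xhat k.+1 =
      x k.+1 + (tau k.+1 * (1 - tau k) / tau k) *: (x k.+1 - x k);
  scheme_ytil : forall k,
    ytil k.+1 =
      ytil k + eta k *: (K *m (x k.+1 - (1 - tau k) *: x k) - tau k *: b);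
  scheme_ybar : forall k,
    ybar k.+1 = (1 - tau k) *: ybar k + tau k *: y k.+1
}.

End Scheme.

Definition bigO_inv (R : realType) (u : nat -> \bar R) : Prop :=
  exists C : R, \forall k \near \oo, (`|u k| <= (C / k%:R)%:E)%E.

Definition R0sq (R : realType) (p n : nat) (K : 'M[R]_(n, p))
    (L rho0 gamma : R) (x0 xs : 'cV[R]_p) (y0 ys : 'cV[R]_n) : R :=
  (rho0 * opnorm K ^+ 2 + gamma * L) / gamma * enorm (x0 - xs) ^+ 2
  + ((1 - gamma) * rho0)^-1 * (2 * enorm ys + enorm y0 + 1) ^+ 2.

Definition D_F (R : realType) (p : nat) (f psi : 'cV[R]_p -> \bar R)
    (x0 : 'cV[R]_p) : \bar R :=
  ereal_sup [set (enorm (x - x0))%:E | x in effdom (objF f psi)].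

(* Main.v *)
Require Import Defs.
From HB Require Import structures.
From mathcomp Require Import all_boot all_order all_algebra.
From mathcomp Require Import all_classical all_reals all_analysis.
From mathcomp Require Import ring lra.

Set Implicit Arguments.
Unset Strict Implicit.
Unset Printing Implicit Defensive.

Import Order.TTheory GRing.Theory Num.Theory.
Import numFieldNormedType.Exports.

Local Open Scope classical_set_scope.
Local Open Scope ring_scope.

(** The scheme is an accelerated proximal gradient method on the augmented
    Lagrangian, with a penalty that grows linearly. Writing the extrapolated
    point as [xhat k = (1 - t k) x k + t k xtil k], where [t k = c / (k + c)], one
    iteration combines the
    optimality condition of the proximal step, the descent lemma for [psi] and
    convexity along the segment from [x k] to an arbitrary reference point [u].
    The dual terms then complete a square ([dual_step_identity]), and division
    by [t k] gives the inequality [scheme_step], for every reference pair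
    [(u, v)] and with [a_k = K x_k - b]:

      (k+c)/c (F x_(k+1) + <v, a_(k+1)>) + rho0/2 |(k+c)/c a_(k+1)|^2 + P_(k+1)
        <= k/c (F x_k + <v, a_k>) + rho0/2 |k/c a_k|^2 + P_k
           + F u + <y_(k+1), K u - b>,

    where [P_k] is a weighted sum of the squared distances of [xtil k] to [u]
    and of [ytil k] to [v].

    For c = 1 this telescopes ([ergodic_gap]). With [u = xs], letting [v] range
    over a ball bounds the objective and the residual ([gap_to_residual]); with
    [v = ys], letting [u] range over the bounded domain bounds the dual gap.

    For c > 1 the two sides use different weights, and the difference is a
    surplus: with [D_k] the Lagrangian gap at [(xs, ys)], it makes the series of
    [D_k + k |a_k|^2] converge, besides [D_k] and [|a_k|] being O(1/k)
    ([descent_rates]). Then the series of [k (D_k + |a_k|)^2] converges, whereas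
    that of [1 / (k log k)] does not; hence the limit inferior
    ([log_improvement]).

    Two facts link this to the problem. The pair [(xs, ys)] is a saddle point
    of the Lagrangian by [strong_duality], a finite-dimensional separation
    argument resting on the relative interior condition. And a smooth closed
    convex function is finite everywhere ([smooth_domT]), so that the gradient
    at [xhat k], possibly outside the domain of [f], makes sense. *)

(** * Euclidean inner product and operator norm *)

Section Euclid.
Variable R : realType.
Implicit Types (m n p : nat).

Lemma dotC m (u v : 'cV[R]_m) : dot u v = dot v u.
Proof. by apply: eq_bigr => i _; rewrite mulrC. Qed.

Lemma dotDl m (u v w : 'cV[R]_m) : dot (u + v) w = dot u w + dot v w.
Proof. by rewrite -big_split; apply: eq_bigr => i _; rewrite mxE mulrDl. Qed.

Lemma dotZl m (a : R) (u w : 'cV[R]_m) : dot (a *: u) w = a * dot u w.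
Proof. by rewrite mulr_sumr; apply: eq_bigr => i _; rewrite mxE mulrA. Qed.

Lemma dotNl m (u w : 'cV[R]_m) : dot (- u) w = - dot u w.
Proof. by rewrite -scaleN1r dotZl mulN1r. Qed.

Lemma dotDr m (u v w : 'cV[R]_m) : dot w (u + v) = dot w u + dot w v.
Proof. by rewrite dotC dotDl dotC [dot v w]dotC. Qed.

Lemma dotZr m (a : R) (u w : 'cV[R]_m) : dot w (a *: u) = a * dot w u.
Proof. by rewrite dotC dotZl dotC. Qed.

Lemma dotNr m (u w : 'cV[R]_m) : dot w (- u) = - dot w u.
Proof. by rewrite dotC dotNl dotC. Qed.

Definition dotE := (dotDl, dotDr, dotNl, dotNr, dotZl, dotZr).

Lemma dot0l m (u : 'cV[R]_m) : dot 0 u = 0.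
Proof. by rewrite -(scale0r 0) dotZl mul0r. Qed.

Lemma dot0r m (u : 'cV[R]_m) : dot u 0 = 0.
Proof. by rewrite dotC dot0l. Qed.

Lemma dot_trmul m n (K : 'M[R]_(n, m)) (u : 'cV[R]_m) (y : 'cV[R]_n) :
  dot (K^T *m y) u = dot y (K *m u).
Proof.
have dot_mx k (v w : 'cV[R]_k) : dot v w = (v^T *m w) 0 0.
  by rewrite mxE; apply: eq_bigr => i _; rewrite mxE.
by rewrite !dot_mx trmx_mul trmxK mulmxA.
Qed.

Lemma dot_ge0 m (u : 'cV[R]_m) : 0 <= dot u u.
Proof. by apply: sumr_ge0 => i _; rewrite -expr2 sqr_ge0. Qed.

Lemma dot_eq0 m (u : 'cV[R]_m) : dot u u = 0 -> u = 0.
Proof.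
move/eqP; rewrite psumr_eq0 => [/allP u0|i _]; last by rewrite -expr2 sqr_ge0.
apply/colP => i; rewrite mxE; apply/eqP.
by have := u0 i; rewrite mem_index_enum /= mulf_eq0 orbb; apply.
Qed.

Lemma enorm_ge0 m (u : 'cV[R]_m) : 0 <= enorm u.
Proof. exact: sqrtr_ge0. Qed.

Lemma enorm_sqr m (u : 'cV[R]_m) : enorm u ^+ 2 = dot u u.
Proof. by rewrite sqr_sqrtr ?dot_ge0. Qed.

Lemma enorm_eq0 m (u : 'cV[R]_m) : enorm u = 0 -> u = 0.
Proof. by move=> u0; apply: dot_eq0; rewrite -enorm_sqr u0 expr0n. Qed.

Lemma enormZ m (a : R) (u : 'cV[R]_m) : enorm (a *: u) = `|a| * enorm u.
Proof.
by rewrite /enorm dotZl dotZr mulrA -expr2 sqrtrM ?sqr_ge0// sqrtr_sqr.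
Qed.

Lemma enorm0 m : enorm (0 : 'cV[R]_m) = 0.
Proof. by rewrite /enorm dot0l sqrtr0. Qed.

Lemma enormN m (u : 'cV[R]_m) : enorm (- u) = enorm u.
Proof. by rewrite -scaleN1r enormZ normrN1 mul1r. Qed.

Lemma enormBC m (u v : 'cV[R]_m) : enorm (u - v) = enorm (v - u).
Proof. by rewrite -opprB enormN. Qed.

Lemma cauchy_schwarz m (u v : 'cV[R]_m) : dot u v <= enorm u * enorm v.
Proof.
have [v0|v0] := eqVneq (enorm v) 0.
  by rewrite (enorm_eq0 v0) dot0r enorm0 mulr0.
have [u0|u0] := eqVneq (enorm u) 0.
  by rewrite (enorm_eq0 u0) dot0l enorm0 mul0r.
have up : 0 < enorm u by rewrite lt_def u0 enorm_ge0.
have vp : 0 < enorm v by rewrite lt_def v0 enorm_ge0.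
have := dot_ge0 (enorm v *: u - enorm u *: v).
rewrite !dotE -!enorm_sqr [dot v u]dotC => h.
have : 0 <= (2 * enorm u * enorm v) * (enorm u * enorm v - dot u v) by lra.
by rewrite pmulr_rge0 ?subr_ge0// !mulr_gt0.
Qed.

Lemma enormD m (u v : 'cV[R]_m) : enorm (u + v) <= enorm u + enorm v.
Proof.
rewrite -(@ler_pXn2r _ 2) ?nnegrE ?addr_ge0 ?enorm_ge0//.
rewrite enorm_sqr !dotE -!enorm_sqr [dot v u]dotC.
by have := cauchy_schwarz u v; lra.
Qed.

Lemma dot_enormN m (u v : 'cV[R]_m) : - (enorm u * enorm v) <= dot u v.
Proof. by rewrite lerNl -dotNl -(enormN u) cauchy_schwarz. Qed.

(** The supremum defining the operator norm is finite: by Cauchy-Schwarz on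
    each row, the Frobenius norm bounds it. *)
Lemma opnorm_has_sup n p (K : 'M[R]_(n, p)) :
  has_sup [set enorm (K *m x) | x in [set x : 'cV[R]_p | enorm x <= 1]].
Proof.
split; first by exists 0, 0; rewrite /= ?enorm0// mulmx0 enorm0.
exists (Num.sqrt (\sum_i enorm (row i K)^T ^+ 2)) => _ [x x1 <-].
apply: ler_wsqrtr; apply: ler_sum => i _.
have -> : (K *m x) i 0 = dot (row i K)^T x.
  by rewrite mxE; apply: eq_bigr => j _; rewrite !mxE.
rewrite -expr2 -real_normK ?num_real// ler_pXn2r ?nnegrE ?enorm_ge0//.
have le : enorm (row i K)^T * enorm x <= enorm (row i K)^T.
  by rewrite ler_piMr ?enorm_ge0.
rewrite ler_norml; apply/andP; split.
  by apply: le_trans (dot_enormN _ _); rewrite lerN2.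
exact: le_trans (cauchy_schwarz _ _) le.
Qed.

Lemma opnorm_ge0 n p (K : 'M[R]_(n, p)) : 0 <= opnorm K.
Proof.
apply: ub_le_sup; first by have [] := opnorm_has_sup K.
by exists 0; rewrite /= ?enorm0// mulmx0 enorm0.
Qed.

Lemma enorm_mulmx n p (K : 'M[R]_(n, p)) (x : 'cV[R]_p) :
  enorm (K *m x) <= opnorm K * enorm x.
Proof.
have [x0|x0] := eqVneq (enorm x) 0.
  by rewrite (enorm_eq0 x0) mulmx0 !enorm0 mulr0.
have xp : 0 < enorm x by rewrite lt_def x0 enorm_ge0.
rewrite -ler_pdivrMr//; apply: ub_le_sup; first by have [] := opnorm_has_sup K.
exists ((enorm x)^-1 *: x); rewrite /= -?scalemxAr enormZ ger0_norm ?invr_ge0//.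
- by rewrite mulVf.
- exact: enorm_ge0.
- by rewrite mulrC.
- exact: enorm_ge0.
Qed.

Lemma opnorm_gt0 n p (K : 'M[R]_(n, p)) : K != 0 -> 0 < opnorm K.
Proof.
move=> K0; rewrite lt_def opnorm_ge0 andbT; apply: contra K0 => /eqP k0.
apply/eqP/matrixP => i j; rewrite [RHS]mxE.
have /enorm_eq0/colP/(_ i) : enorm (K *m delta_mx j 0) = 0.
  apply/eqP; rewrite eq_le enorm_ge0 andbT.
  by have := enorm_mulmx K (delta_mx j 0); rewrite k0 mul0r.
by rewrite -colE !mxE.
Qed.

End Euclid.

(** * Lagrange multipliers and strong duality *)

Section Duality.
Variable R : realType.

(** A finite-dimensional Hahn-Banach theorem for convex cones. The multiplier is
    built one coordinate at a time. Since every direction of the cone has an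
    opposite one, the cone either constrains the next coordinate from both sides
    or contains no direction along that axis, so that no closedness argument is
    called for. *)
Lemma multiplier_exists n (S : 'cV[R]_n -> R -> Prop)
    (S_add : forall u v s t, S u s -> S v t -> S (u + v) (s + t))
    (S_scale : forall u s a, 0 < a -> S u s -> S (a *: u) (a * s))
    (S_sym : forall u s, S u s -> exists t, S (- u) t)
    (S_pos : forall s, S 0 s -> 0 <= s) :
  exists v : 'cV[R]_n, forall u s, S u s -> dot v u <= s.
Proof.
elim: n S S_add S_scale S_sym S_pos => [|n IHn] S S_add S_scale S_sym S_pos.
  exists 0 => u s Sus; rewrite dot0l; apply: S_pos.
  by rewrite -(flatmx0 u).
pose up (a : R) (u : 'cV[R]_n) : 'cV[R]_n.+1 := col_mx (a%:M : 'cV_1) u.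
have upE (w : 'cV[R]_n.+1) : w = up (w 0 0) (dsubmx (w : 'cV_(1 + n))).
  rewrite /up; have -> : (w 0 0)%:M = usubmx (w : 'cV_(1 + n)) :> 'cV_1.
    apply/colP => i; rewrite !mxE !ord1 eqxx mulr1n; congr (w _ _).
    exact/val_inj.
  exact/esym/(@vsubmxK _ 1 n 1).
have upD a b u v : up a u + up b v = up (a + b) (u + v).
  by rewrite /up (@add_col_mx _ 1 n) raddfD.
have upZ a b u : a *: up b u = up (a * b) (a *: u).
  by rewrite /up (@scale_col_mx _ 1 n) scale_scalar_mx.
have up0 : up 0 0 = 0 by rewrite /up raddf0 (@col_mx0 _ 1 n).
have upN b u : - up b u = up (- b) (- u) by rewrite -scaleN1r upZ mulN1r scaleN1r.
have dot_up a u b v : dot (up a u) (up b v) = a * b + dot u v.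
  rewrite /dot (@big_split_ord _ _ _ 1 n) big_ord1 /up; congr (_ + _).
    by rewrite !(@col_mxEu _ 1 n) !mxE !mulr1n.
  by apply: eq_bigr => i _; rewrite !(@col_mxEd _ 1 n).
(* The slopes of S along the first axis, on either side of the origin, do not
   cross; lam is a value between them. *)
have [lam lamP] : exists lam, forall a t, S (up a 0) t -> lam * a <= t.
  pose A := [set l | exists t, S (up (- 1) 0) t /\ l = - t].
  have unit a t : 0 < `|a| -> S (up a 0) t -> S (up (Num.sg a) 0) (t / `|a|).
    move=> a0 /(S_scale _ _ `|a|^-1); rewrite invr_gt0 => /(_ a0).
    suff e : `|a|^-1 * a = Num.sg a by rewrite upZ scaler0 e mulrC.
    by rewrite mulrC [X in X / _]numEsg mulfK// gt_eqF.
  have A_ub t : S (up 1 0) t -> ubound A t.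
    move=> St _ [s [Ss ->]].
    by have := S_add _ _ _ _ St Ss; rewrite upD subrr addr0 up0 => /S_pos; lra.
  have [[t0 St0]|noS] := pselect (exists t, S (up 1 0) t); last first.
    exists 0 => a t Sa; rewrite mul0r; have [a0|a0|a0] := ltgtP 0 a.
    - case: noS; exists (t / `|a|); rewrite -[X in up X](gtr0_sg a0).
      by apply: unit => //; rewrite normr_gt0 gt_eqF.
    - have /S_sym[t'] : S (up (- 1) 0) (t / `|a|).
        by rewrite -[X in up X](ltr0_sg a0); apply: unit; rewrite ?normr_gt0 ?lt_eqF.
      by rewrite upN opprK oppr0 => St'; case: noS; exists t'.
    - by apply: S_pos; rewrite -up0 a0.
  have A_sup : has_sup A.
    split; last by exists t0; exact: A_ub.
    have [t'] := S_sym _ _ St0; rewrite upN oppr0 => St'.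
    by exists (- t'), t'.
  exists (sup A) => a t Sa; have [a0|a0|a0] := ltgtP 0 a.
  - have := unit a t; rewrite normr_gt0 gt_eqF// gtr0_sg// gtr0_norm//.
    move=> /(_ isT Sa) /A_ub h; rewrite -ler_pdivlMr//.
    by apply: ge_sup => //; case: A_sup.
  - have := unit a t; rewrite normr_gt0 lt_eqF// ltr0_sg// ltr0_norm//.
    move=> /(_ isT Sa) h; have : - (t / - a) <= sup A.
      by apply: ub_le_sup; [case: A_sup|exists (t / - a)].
    by rewrite invrN mulrN opprK ler_ndivrMr.
  - by rewrite -a0 mulr0; apply: S_pos; rewrite -up0 a0.
pose S' u s := exists a t, S (up a u) t /\ s = t - lam * a.
have [] := IHn S'.
- move=> u v _ _ [a [t [St ->]]] [b [s [Ss ->]]].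
  exists (a + b), (t + s); split; last by lra.
  by rewrite -upD; apply: S_add.
- move=> u _ k k0 [a [t [St ->]]]; exists (k * a), (k * t); split; last by lra.
  by rewrite -upZ; apply: S_scale.
- move=> u _ [a [t [/S_sym[t' St'] _]]].
  by exists (t' - lam * - a), (- a), t'; rewrite -upN.
- by move=> _ [a [t [St ->]]]; rewrite subr_ge0; apply: lamP.
move=> v vP; exists (up lam v) => u s; rewrite [u]upE dot_up => Su.
by rewrite addrC -lerBrDr; apply: vP; eexists; eexists; split; first exact: Su.
Qed.

Definition convex_on m (D : set 'cV[R]_m) (F : 'cV[R]_m -> R) :=
  forall x z t, D x -> D z -> 0 <= t <= 1 ->
    D (t *: x + (1 - t) *: z) /\
    F (t *: x + (1 - t) *: z) <= t * F x + (1 - t) * F z.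

(** The new point lies on the line through [x] and [z], hence in the affine
    hull, and the choice of [d] brings it within the radius given by [ri]. *)
Lemma ri_reflect m (D : set 'cV[R]_m) x z : ri D x -> D z ->
  exists2 d, 0 < d & D (x - d *: (z - x)).
Proof.
move=> [Dx [e e0 De]] Dz; pose d := e / (2 * (enorm (z - x) + 1)).
have N0 := enorm_ge0 (z - x).
have d0 : 0 < d by rewrite divr_gt0 ?mulr_gt0 ?ltr_wpDl.
exists d => //; apply: De.
  exists 2%N, (fun i => if i == 0 then 1 + d else - d).
  exists (fun i => if i == 0 then x else z).
  split; first by move=> i; case: ifP.
    by rewrite big_ord_recl big_ord1 /=; lra.
  rewrite big_ord_recl big_ord1 /=.
  by apply/colP => i; rewrite !mxE; ring.
have -> : x - d *: (z - x) - x = (- d) *: (z - x).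
  by apply/colP => i; rewrite !mxE; ring.
have : d * (2 * (enorm (z - x) + 1)) = e.
  by rewrite divfK// gt_eqF// mulr_gt0// ltr_wpDl.
by rewrite enormZ normrN gtr0_norm//; lra.
Qed.

(** The multiplier separates the cone generated by the pairs of a constraint
    value and an excess of the objective over the optimal value. The relative
    interior provides the opposite directions that the separation asks for. *)
Lemma lagrange_multiplier p n (D : set 'cV[R]_p) (F : 'cV[R]_p -> R)
    (K : 'M[R]_(n, p)) (b : 'cV[R]_n) (Fs : R) (xb : 'cV[R]_p) :
  convex_on D F -> ri D xb -> K *m xb = b ->
  (forall x, D x -> K *m x = b -> Fs <= F x) ->
  exists y : 'cV[R]_n, forall x, D x -> Fs <= F x + dot y (K *m x - b).
Proof.
move=> cvx rix Kx opt.
pose S (u : 'cV[R]_n) t := exists z s,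
  [/\ D z, 0 < s, u = s *: (K *m z - b) & s * (F z - Fs) <= t].
have [] := @multiplier_exists n S.
- move=> _ _ t1 t2 [z1 [s1 [D1 s10 -> le1]]] [z2 [s2 [D2 s20 -> le2]]].
  have s0 : 0 < s1 + s2 by rewrite addr_gt0.
  have sn0 := lt0r_neq0 s0.
  pose t := s1 / (s1 + s2).
  have t01 : 0 <= t <= 1.
    apply/andP; split; first by rewrite divr_ge0 ?ltW.
    by rewrite ler_pdivrMr// mul1r lerDl ltW.
  have st : (s1 + s2) * t = s1 by rewrite /t mulrCA mulfV// mulr1.
  have st' : (s1 + s2) * (1 - t) = s2 by rewrite mulrBr st mulr1 addrAC subrr add0r.
  clearbody t; have [Dz Fz] := cvx _ _ t D1 D2 t01.
  exists (t *: z1 + (1 - t) *: z2), (s1 + s2); split => //.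
    rewrite mulmxDr -!scalemxAr; apply/colP => i; rewrite !mxE.
    rewrite -[X in X * _ + _]st -[X in _ + X * _]st'; ring.
  apply: le_trans (lerD le1 le2).
  rewrite -[X in _ <= X * _ + _]st -[X in _ <= _ + X * _]st'.
  rewrite -!mulrA -mulrDr ler_pM2l//; lra.
- move=> _ t a a0 [z [s [Dz s0 -> le]]].
  exists z, (a * s); split => //; first by rewrite mulr_gt0.
    by rewrite scalerA.
  by rewrite -mulrA ler_pM2l.
- move=> _ t [z [s [Dz s0 -> le]]].
  have [d d0 Dw] := ri_reflect rix Dz.
  eexists; exists (xb - d *: (z - xb)), (s / d); split => //.
    by rewrite divr_gt0.
  rewrite mulmxBr -scalemxAr mulmxBr Kx; apply/colP => i; rewrite !mxE.
  by field; rewrite gt_eqF.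
- move=> t [z [s [Dz s0 /esym/eqP u0 le]]]; apply: le_trans le.
  move: u0; rewrite scaler_eq0 gt_eqF//= subr_eq0 => /eqP Kz.
  by rewrite pmulr_rge0// subr_ge0 opt.
move=> v vP; exists (- v) => x Dx; rewrite dotNl -lerBlDr opprK.
rewrite -lerBrDl; apply: vP; exists x, 1; split => //.
  by rewrite scale1r.
by rewrite mul1r.
Qed.

Section FineConvex.
Variable m : nat.
Implicit Types h : 'cV[R]_m -> \bar R.

Lemma fineK_dom h x : proper_fun h -> effdom h x -> (fine (h x))%:E = h x.
Proof.
by move=> [hN _] hx; rewrite fineK// fin_numE hN -ltey.
Qed.

Lemma convex_fine h : proper_fun h -> convex_fun h ->
  convex_on (effdom h) (fine \o h).
Proof.
move=> hp hc x z t dx dz t01 /=.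
have := hc x z t t01; rewrite -(fineK_dom hp dx) -(fineK_dom hp dz).
rewrite -!EFinM -EFinD => le.
have d : effdom h (t *: x + (1 - t) *: z) by exact: le_lt_trans le (ltry _).
by split => //; move: le; rewrite -(fineK_dom hp d) lee_fin.
Qed.

End FineConvex.

Section StrongDuality.
Variables (p n : nat) (f psi : 'cV[R]_p -> \bar R).
Variables (K : 'M[R]_(n, p)) (b : 'cV[R]_n).
Hypotheses (f_proper : proper_fun f) (psi_proper : proper_fun psi).

Lemma effdom_objF : effdom (objF f psi) = effdom f `&` effdom psi.
Proof.
have [fN _] := f_proper; have [pN _] := psi_proper.
apply/seteqP; split => x; rewrite /effdom /objF /=; last first.
  by move=> [fx px]; rewrite lte_add_pinfty.
by move: (fN x) (pN x); case: (f x) (psi x) => [?||] [?||] //=; rewrite ?ltry.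
Qed.

Lemma objFE x : effdom f x -> effdom psi x ->
  objF f psi x = (fine (f x) + fine (psi x))%:E.
Proof.
by move=> fx px; rewrite /objF EFinD !fineK_dom.
Qed.

Lemma dualG_le y (q : R) :
  (forall u, effdom f u -> effdom psi u ->
     - q <= fine (f u) + fine (psi u) + dot y (K *m u - b)) ->
  (dualG f psi K b y <= q%:E)%E.
Proof.
move=> q_le; rewrite -leeBrDr//; apply: ge_ereal_sup => _ [x _ <-].
have [[fx px]|] := pselect ((effdom f `&` effdom psi) x).
  have := q_le _ fx px.
  rewrite -(fineK_dom f_proper fx) -(fineK_dom psi_proper px).
  rewrite -!EFinB lee_fin dotNl dot_trmul !dotE [dot b y]dotC; lra.
rewrite -effdom_objF /effdom /objF /=.
have [fN _] := f_proper; have [pN _] := psi_proper.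
by move: (fN x) (pN x); case: (f x) (psi x) => [?||] [?||] //=; rewrite ?ltry ?leNye.
Qed.

(** At the primal solution, the expression maximised in the dual function equals
    minus the optimal value, whatever the multiplier: this is weak duality. The
    multiplier given by the qualification condition shows that the dual optimal
    value is no larger; hence every dual solution is such a multiplier too. *)
Lemma strong_duality xs ys xb :
  convex_fun f -> convex_fun psi ->
  ri (effdom f `&` effdom psi) xb -> K *m xb = b ->
  primal_sol f psi K b xs -> dual_sol f psi K b ys ->
  [/\ effdom f xs /\ effdom psi xs,
      Gstar f psi K b = (- (fine (f xs) + fine (psi xs)))%:E &
      forall x, effdom f x -> effdom psi x ->
        fine (f xs) + fine (psi xs) <=
        fine (f x) + fine (psi x) + dot ys (K *m x - b)].
Proof.
move=> fc pc rix Kxb [Kxs Fxs] ysP.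
have [[dfb dpb] _] := rix.
have Fs_le x : K *m x = b -> (objF f psi xs <= objF f psi x)%E.
  by move=> Kx; rewrite Fxs; apply: ereal_inf_lbound; exists x.
have [dfs dps] : (effdom f `&` effdom psi) xs.
  rewrite -effdom_objF; apply: le_lt_trans (Fs_le _ Kxb) _.
  by rewrite objFE// ltry.
set Fs := fine (f xs) + fine (psi xs).
have cvx : convex_on (effdom f `&` effdom psi)
    (fun x => fine (f x) + fine (psi x)).
  move=> x z t [fx px] [fz pz] t01.
  have [df lef] := convex_fine f_proper fc fx fz t01.
  have [dp lep] := convex_fine psi_proper pc px pz t01.
  by split => //=; move: lef lep => /=; lra.
have [] := @lagrange_multiplier _ _ _ _ K b Fs xb cvx rix Kxb.
  by move=> x [fx px] /Fs_le; rewrite !objFE// lee_fin.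
move=> y0 y0P.
have G_ge y : ((- Fs)%:E <= dualG f psi K b y)%E.
  have -> : ((- Fs)%:E = (dot (- (K^T *m y)) xs)%:E - f xs - psi xs + (dot b y)%:E)%E.
    rewrite -(fineK_dom f_proper dfs) -(fineK_dom psi_proper dps).
    rewrite -!EFinB -EFinD dotNl dot_trmul Kxs [dot b y]dotC; congr EFin.
    by rewrite /Fs; ring.
  by apply: leeD => //; apply: ereal_sup_ubound; exists xs.
have G_le : (dualG f psi K b y0 <= (- Fs)%:E)%E.
  by apply: dualG_le => x fx px; rewrite opprK; exact: y0P.
have GsE : Gstar f psi K b = (- Fs)%:E.
  apply/eqP; rewrite eq_le; apply/andP; split.
    by apply: le_trans G_le; apply: ereal_inf_lbound; exists y0.
  by apply: le_ereal_inf_tmp => _ [y _ <-].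
split => // x fx px.
have : ((dot (- (K^T *m ys)) x)%:E - f x - psi x + (dot b ys)%:E <= (- Fs)%:E)%E.
  rewrite -GsE -ysP; apply: leeD => //.
  by apply: ereal_sup_ubound; exists x.
rewrite -(fineK_dom f_proper fx) -(fineK_dom psi_proper px).
rewrite -!EFinB -EFinD lee_fin dotNl dot_trmul !dotE [dot b ys]dotC.
by rewrite /Fs; lra.
Qed.

End StrongDuality.

End Duality.

(** * Smooth convex functions *)

Section SmoothConvex.
Variables (R : realType) (m : nat).
Implicit Types (h : 'cV[R]_m -> \bar R) (x z : 'cV[R]_m).

Lemma dot_le_perturb (g g' v : 'cV[R]_m) (c : R) :
  enorm (g - g') <= c -> dot g v <= dot g' v + c * enorm v.
Proof.
move=> le; rewrite -lerBlDl -dotNl -dotDl.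
by apply: le_trans (cauchy_schwarz _ _) _; rewrite ler_wpM2r ?enorm_ge0.
Qed.

Lemma dot_gradient h x v : differentiable (fine \o h) x ->
  dot (gradient h x) v = 'd (fine \o h) x v.
Proof.
move=> dh; rewrite [in RHS](matrix_sum_delta v) linear_sum.
by apply: eq_bigr => i _; rewrite big_ord1 linearZ /= mxE mulrC.
Qed.

Lemma gradient_le h x z : proper_fun h -> convex_fun h ->
  differentiable_ext h x -> effdom h x -> effdom h z ->
  fine (h x) + dot (gradient h x) (z - x) <= fine (h z).
Proof.
move=> hp hc [_ dh] dx dz; rewrite dot_gradient// -deriveE// -lerBrDl.
have /cvg_dnbhs_at_right := diff_derivable (v := z - x) dh.
move=> /cvgr_to_le; apply; near=> t.
have t0 : 0 < t by near: t; exact: nbhs_right_gt.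
have t1 : t <= 1 by near: t; exact: nbhs_right_le.
have t01 : 0 <= t <= 1 by rewrite ltW.
have [_ /= le] := convex_fine hp hc dz dx t01.
rewrite /GRing.scale /= ler_pdivrMl//.
suff -> : t *: (z - x) + x = t *: z + (1 - t) *: x by lra.
by apply/colP => i; rewrite !mxE; ring.
Unshelve. all: by end_near. Qed.

(** The gradient is presented through an abstract map having the two properties
    used below, since deciding whether two gradients are convertible would
    unfold the definition of the derivative. *)
Lemma smooth_gradientP h L : proper_fun h -> convex_fun h -> smooth L h ->
  exists G : 'cV[R]_m -> 'cV[R]_m, [/\ G = gradient h,
    forall x z, effdom h x -> effdom h z ->
      fine (h x) + dot (G x) (z - x) <= fine (h z) &
    forall x z, effdom h x -> effdom h z -> enorm (G x - G z) <= L * enorm (x - z)].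
Proof.
move=> hp hc [L0 dh lip]; exists (gradient h); split => // x z dx dz.
by apply: gradient_le => //; apply: dh.
Qed.

(** The domain of a smooth function is open since differentiability requires
    finite values nearby. It is also closed: the Lipschitz gradient bounds the
    function on its domain by a quadratic, and a closed epigraph passes this
    bound to limits. On each line through a point of the domain, connectedness
    concludes. *)
Lemma smooth_domT h (L : R) x : proper_fun h -> closed_fun h -> convex_fun h ->
  smooth L h -> effdom h x.
Proof.
move=> hp hcl hc hs; have [x0 dx0] := hp.2.
have [G [_ Gle Glip]] := smooth_gradientP hp hc hs; have [_ dh _] := hs.
have [d dE] : exists d, x = x0 + d by exists (x - x0); rewrite addrC subrK.
pose l (s : R) := x0 + s *: d.
have l_cont : continuous l.
  move=> s; apply: cvgD; first exact: cvg_cst.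
  by apply: cvgZr_tmp; exact: cvg_id.
pose A := [set s : R | effdom h (l s)].
pose q (s : R) := fine (h x0) + s * dot (G x0) d + L * s ^+ 2 * dot d d.
have q_cont : continuous q.
  move=> s; apply: cvgD; last first.
    by apply: cvgMr_tmp; apply: cvgMl_tmp; exact: exprn_continuous.
  by apply: cvgD; [exact: cvg_cst|apply: cvgMr_tmp; exact: cvg_id].
have A_epi : A = [set s | (h (l s) <= (q s)%:E)%E].
  apply/seteqP; split => s; last by move=> /= /le_lt_trans; apply; rewrite ltry.
  rewrite /A /= => ds; rewrite -(fineK_dom hp ds) lee_fin.
  have := Gle _ _ ds dx0.
  have -> : x0 - l s = (- s) *: d by rewrite /l opprD addNKr scaleNr.
  have lip_s : enorm (G (l s) - G x0) <= L * enorm (s *: d).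
    by have := Glip _ _ ds dx0; rewrite /l addrAC subrr add0r.
  have := dot_le_perturb (s *: d) lip_s; rewrite -mulrA -expr2 enorm_sqr /q.
  by rewrite !dotE; lra.
have A0 : A 0 by rewrite /A /= /l scale0r addr0.
have Aopen : open A.
  rewrite openE => s As; have [fin_near _] := dh _ As.
  apply: (@filterS _ _ _ [set s | h (l s) \is a fin_num]).
    by move=> t /=; rewrite /A /= /effdom /= ltey fin_numE => /andP[].
  exact: l_cont fin_near.
have Aclosed : closed A.
  have -> : A = (fun s => (l s, q s)) @^-1` [set xt | (h xt.1 <= xt.2%:E)%E].
    by rewrite A_epi.
  apply: closed_comp hcl => s _; exact: (cvg_pair (l_cont s) (q_cont s)).
have AT : A = setT.
  have cT : connected [set: R] by apply/connected_intervalP; move=> ? ? ? ?.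
  by rewrite -[A]setTI; apply: cT; [exists 0|exists A; rewrite ?setTI|exists A; rewrite ?setTI].
have : A 1 by rewrite AT.
by rewrite /A /= /l scale1r -dE.
Qed.

(** Sum the subgradient inequality over a subdivision of the segment into N
    equal pieces, each taken at its far end: the Riemann sum of [L * t] tends
    to [L / 2]. *)
Lemma descent (F : 'cV[R]_m -> R) (G : 'cV[R]_m -> 'cV[R]_m) (L : R) x z :
  (forall u v, F u + dot (G u) (v - u) <= F v) ->
  (forall u v, enorm (G u - G v) <= L * enorm (u - v)) ->
  F z <= F x + dot (G x) (z - x) + L / 2 * enorm (z - x) ^+ 2.
Proof.
move=> Gle Glip.
set d := z - x; set g := dot (G x) d; set N2 := enorm d ^+ 2.
have step (s t : R) : 0 <= s -> s <= t ->
    F (x + t *: d) <= F (x + s *: d) + (t - s) * (g + L * t * N2).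
  move=> s0 st; have t0 : 0 <= t := le_trans s0 st.
  have := Gle (x + t *: d) (x + s *: d).
  have -> : x + s *: d - (x + t *: d) = - ((t - s) *: d).
    by apply/colP => i; rewrite !mxE; ring.
  rewrite dotNr dotZr lerBlDr => /le_trans; apply; rewrite lerD2l.
  rewrite ler_wpM2l ?subr_ge0// /g /N2 expr2 mulrA.
  apply: dot_le_perturb; have := Glip (x + t *: d) x.
  by rewrite addrAC subrr add0r enormZ ger0_norm// mulrA.
have bound (N : nat) : F z <= F x + g + L / 2 * N2
    + (L / 2 * N2) * N.+1%:R^-1.
  have N0 : N.+1%:R != 0 :> R by rewrite pnatr_eq0.
  have part (i : nat) : F (x + (i%:R / N.+1%:R) *: d) <=
      F x + i%:R / N.+1%:R * g
      + L / 2 * N2 * (i%:R * (i%:R + 1)) / N.+1%:R ^+ 2.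
    elim: i => [|i IHi]; first by rewrite !mul0r scale0r !addr0 mulr0 mul0r addr0.
    have le1 : i%:R / N.+1%:R <= i.+1%:R / N.+1%:R :> R.
      by rewrite ler_pM2r ?invr_gt0// ler_nat.
    have := step _ _ _ le1; rewrite divr_ge0// => /(_ isT) /le_trans; apply.
    apply: le_trans (lerD IHi (lexx _)) _.
    rewrite le_eqVlt; apply/orP; left; apply/eqP.
    by rewrite -[i.+1%:R]natr1; field.
  have := part N.+1; rewrite divff// scale1r mul1r [in F _]/d addrC subrK.
  move/le_trans; apply.
  rewrite le_eqVlt; apply/orP; left; apply/eqP; field.
  by [].
have : (fun N => F x + g + L / 2 * N2 + (L / 2 * N2) * N.+1%:R^-1 : R)
    @ \oo --> F x + g + L / 2 * N2 + (L / 2 * N2) * 0.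
  apply: cvgD; first exact: cvg_cst.
  by apply: cvgMl_tmp; exact: cvg_harmonic.
by rewrite mulr0 addr0 => /cvgr_to_ge; apply; apply: nearW.
Qed.

End SmoothConvex.

(** * The proximal step *)

Section Prox.
Variables (R : realType) (m : nat).

Lemma le0_of_small (a c : R) : (forall t, 0 < t <= 1 -> a <= t * c) -> a <= 0.
Proof.
move=> h; rewrite leNgt; apply/negP => a0.
have := h 1; rewrite ltr01 lexx mul1r => /(_ isT) ac.
have c0 : 0 < c := lt_le_trans a0 ac.
have := h (a / (2 * c)); rewrite divr_gt0 ?mulr_gt0//.
rewrite ler_pdivrMr ?mulr_gt0// => /(_ ltac:(lra)).
have -> : a / (2 * c) * c = a / 2 by field; rewrite gt_eqF.
by lra.
Qed.

(** The optimality condition of the proximal step, in the form of a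
    subgradient inequality: compare the minimiser with the points of the
    segment towards u, and let them tend to it. *)
Lemma prox_subgradient (f : 'cV[R]_m -> \bar R) (beta : R) w z :
  proper_fun f -> convex_fun f -> 0 < beta ->
  is_prox (fun u => beta%:E * f u)%E w z ->
  effdom f z /\ forall u, effdom f u ->
    fine (f z) + beta^-1 * dot (w - z) (u - z) <= fine (f u).
Proof.
move=> fp fc b0 zP.
have dz : effdom f z.
  have [u du] := fp.2; have := zP u; rewrite -(fineK_dom fp du).
  rewrite /effdom /=; have := fp.1 z; case: (f z) => [r||] //= _; first by rewrite ltry.
  by rewrite gt0_muley ?lte_fin// addye// -EFinM -EFinD leye_eq.
split => // u du.
have zle v : effdom f v -> beta * fine (f z) + 2^-1 * enorm (z - w) ^+ 2 <=
    beta * fine (f v) + 2^-1 * enorm (v - w) ^+ 2.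
  by move=> dv; have := zP v; rewrite -(fineK_dom fp dv) -(fineK_dom fp dz)
    -!EFinM -!EFinD lee_fin.
rewrite -(ler_pM2l b0) mulrDr mulrA divff ?gt_eqF// mul1r -subr_le0.
apply: (@le0_of_small _ (2^-1 * enorm (u - z) ^+ 2)) => t /andP[t0 t1].
have t01 : 0 <= t <= 1 by rewrite ltW.
have [dv /= le] := convex_fine fp fc du dz t01.
have := zle _ dv.
have -> : t *: u + (1 - t) *: z - w = (z - w) + t *: (u - z).
  by apply/colP => i; rewrite !mxE; ring.
have -> : w - z = - (z - w) by rewrite opprB.
rewrite !enorm_sqr dotNl; move: (z - w) (u - z) => A B.
rewrite !dotE [dot B A]dotC => le2.
rewrite -(ler_pM2l t0).
have : beta * fine (f (t *: u + (1 - t) *: z)) <=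
       beta * (t * fine (f u) + (1 - t) * fine (f z)) by rewrite ler_pM2l.
by lra.
Qed.

End Prox.

(** * One iteration *)

Section Step.
Variable R : realType.

(** All the terms of one iteration that live in the dual space cancel, except
    for the square of [q - s + gamma *: s]; this is where the relation
    eb = (1 - gamma) * rho * tau between the two dual steps is used. *)
Lemma dual_step_identity n (a q s r y yt : 'cV[R]_n) (gamma rho tau eb : R) :
  gamma != 0 -> rho != 0 -> tau != 0 -> 1 - gamma != 0 ->
  eb = (1 - gamma) * rho * tau ->
  let yp := yt + rho *: ((1 - tau) *: a + tau *: q) in
  let ap := (1 - tau) *: a + tau *: s in
  let ytp := yt + eb *: s in
  (1 - tau) * dot y a + rho * (1 - tau) ^+ 2 / 2 * dot a a + tau * dot yp r
  + tau / (2 * eb) * (dot (yt - y) (yt - y) - dot (ytp - y) (ytp - y))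
  + tau * dot yp (s - r) + tau ^+ 2 * rho / (2 * gamma) * dot (q - s) (q - s)
  - (dot y ap + rho / 2 * dot ap ap)
  = rho * tau ^+ 2 / (2 * gamma) * dot (q - s + gamma *: s) (q - s + gamma *: s).
Proof.
move=> g0 rho0 tau0 g1 -> /=.
rewrite !dotE ?(dotC q a) ?(dotC s a) ?(dotC s q) ?(dotC s y).
rewrite ?(dotC a y) ?(dotC q y) ?(dotC yt y) ?(dotC s yt).
by field; rewrite ?g0 ?rho0 ?tau0 ?g1.
Qed.

(** The hypothesis on [F'] gathers the proximal inequality, the descent lemma
    and convexity, all compared at the point [z]. The step size has
    [B = opnorm K ^+ 2 * rho / gamma + L], where [L] absorbs the error of the
    descent lemma and the rest pays for the square of [q - s] needed in
    [dual_step_identity]. *)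
Lemma primal_dual_step p n (K : 'M[R]_(n, p)) (b : 'cV[R]_n)
    (xk xt xt' u : 'cV[R]_p) (yt y : 'cV[R]_n)
    (gamma rho tau eb L Fk Fu F' : R) :
  0 < gamma < 1 -> 0 < rho -> 0 < tau ->
  eb = (1 - gamma) * rho * tau ->
  let xh := (1 - tau) *: xk + tau *: xt in
  let x' := (1 - tau) *: xk + tau *: xt' in
  let z := (1 - tau) *: xk + tau *: u in
  let y' := yt + rho *: (K *m xh - b) in
  let B := opnorm K ^+ 2 * rho / gamma + L in
  F' <= (1 - tau) * Fk + tau * Fu + B * dot (xh - x') (x' - z)
        - dot y' (K *m (x' - z)) + L / 2 * enorm (x' - xh) ^+ 2 ->
  F' + dot y (K *m x' - b) + rho / 2 * enorm (K *m x' - b) ^+ 2 <=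
    (1 - tau) * (Fk + dot y (K *m xk - b))
    + rho * (1 - tau) ^+ 2 / 2 * enorm (K *m xk - b) ^+ 2
    + tau * (Fu + dot y' (K *m u - b))
    + tau ^+ 2 * B / 2 * (enorm (xt - u) ^+ 2 - enorm (xt' - u) ^+ 2)
    + tau / (2 * eb) *
      (enorm (yt - y) ^+ 2 - enorm (yt + eb *: (K *m xt' - b) - y) ^+ 2).
Proof.
move=> /andP[g0 g1] rho0 tau0 ebE xh x' z y' B.
set a := K *m xk - b; set q := K *m xt - b; set s := K *m xt' - b.
set r := K *m u - b.
have aff v : K *m ((1 - tau) *: xk + tau *: v) - b
    = (1 - tau) *: a + tau *: (K *m v - b).
  by rewrite mulmxDr -!scalemxAr; apply/colP => i; rewrite !mxE; ring.
rewrite /y' !aff -/q -/s.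
have -> : x' - z = tau *: (xt' - u).
  by apply/colP => i; rewrite !mxE; ring.
have -> : xh - x' = tau *: ((xt - u) - (xt' - u)).
  by apply/colP => i; rewrite !mxE; ring.
have -> : x' - xh = (- tau) *: ((xt - u) - (xt' - u)).
  by apply/colP => i; rewrite !mxE; ring.
have -> : K *m (tau *: (xt' - u)) = tau *: (s - r).
  by rewrite -scalemxAr mulmxBr; congr (_ *: _); rewrite /s /r opprB addrA subrK.
have qs : enorm (q - s) ^+ 2 <= opnorm K ^+ 2 * enorm ((xt - u) - (xt' - u)) ^+ 2.
  rewrite -exprMn ler_pXn2r ?nnegrE ?mulr_ge0 ?enorm_ge0 ?opnorm_ge0//.
  rewrite (_ : q - s = K *m (xt - u - (xt' - u))) ?enorm_mulmx//.
  by rewrite !mulmxBr; apply/colP => i; rewrite !mxE; ring.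
have qs' : tau ^+ 2 * rho / (2 * gamma) * enorm (q - s) ^+ 2 <=
    tau ^+ 2 * rho / (2 * gamma) *
      (opnorm K ^+ 2 * enorm ((xt - u) - (xt' - u)) ^+ 2).
  by rewrite ler_wpM2l// divr_ge0 ?mulr_ge0 ?sqr_ge0 ?ltW.
have key := @dual_step_identity _ a q s r y yt gamma rho tau eb.
have {key} := key _ _ _ _ ebE; rewrite !gt_eqF ?subr_gt0// => /(_ isT isT isT isT) /= key.
have sq : 0 <= rho * tau ^+ 2 / (2 * gamma) *
    dot (q - s + gamma *: s) (q - s + gamma *: s).
  by rewrite mulr_ge0 ?dot_ge0// divr_ge0 ?mulr_ge0 ?sqr_ge0 ?ltW.
move: qs' sq key; rewrite !enorm_sqr.
move: (yt + rho *: _) (xt - u) (xt' - u) => yp d1 d2.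
move: (dot (q - s + _) _) (dot (q - s) _) => S1 S2.
move: (dot ((1 - tau) *: a + tau *: s) _) => S3.
rewrite !(dotZl, dotZr, dotDl d1, dotDr d1, dotNl, dotNr) ?(dotC d2 d1).
move: (opnorm K ^+ 2) @B => M /=.
have -> : tau ^+ 2 * rho / (2 * gamma) = tau ^+ 2 / 2 * (rho / gamma).
  by field; rewrite gt_eqF.
rewrite -[M * rho / gamma]mulrA; move: (rho / gamma) => rg.
move: (tau / (2 * eb)) (rho * tau ^+ 2 / (2 * gamma)) => T1 T2.
by move=> h1 h2 h3 h4; lra.
Qed.

End Step.

(** * The iterates of the scheme *)

Section Iterates.
Variables (R : realType) (p n : nat).
Variables (f psi : 'cV[R]_p -> \bar R) (K : 'M[R]_(n, p)) (b : 'cV[R]_n).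
Variables (L rho0 c gamma : R) (x0 : 'cV[R]_p) (y0 : 'cV[R]_n).
Variables (x xhat : nat -> 'cV[R]_p) (y ytil ybar : nat -> 'cV[R]_n).
Hypotheses (f_proper : proper_fun f) (f_convex : convex_fun f).
Hypotheses (psi_proper : proper_fun psi) (psi_closed : closed_fun psi).
Hypotheses (psi_convex : convex_fun psi) (psi_smooth : smooth L psi).
Hypotheses (rho0_gt0 : 0 < rho0) (c_ge1 : 1 <= c) (gamma01 : 0 < gamma < 1).
Hypothesis step_defined : K != 0 \/ 0 < L.
Hypothesis generated : scheme f psi K b L rho0 c gamma x0 y0 x xhat y ytil ybar.

Local Notation t := (tau c).
Definition objR (u : 'cV[R]_p) : R := fine (f u) + fine (psi u).
Definition lagrangian (u : 'cV[R]_p) (v : 'cV[R]_n) : R :=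
  objR u + dot v (K *m u - b).

(** The extrapolation is a convex combination in disguise:
    [xhat k] lies between [x k] and this auxiliary point, which is the one whose
    distance to a reference point decreases. *)
Definition xtil (k : nat) : 'cV[R]_p :=
  if k is j.+1 then (t j)^-1 *: (x j.+1 - (1 - t j) *: x j) else x 0%N.

Definition primal_weight (k : nat) : R :=
  (opnorm K ^+ 2 * rho0 + gamma * L * t k) / gamma.

Definition dual_step : R := (1 - gamma) * rho0.

Definition potential (k : nat) u v : R :=
  primal_weight k / 2 * enorm (xtil k - u) ^+ 2
  + (2 * dual_step)^-1 * enorm (ytil k - v) ^+ 2.

Let c_gt0 : 0 < c. Proof. exact: lt_le_trans c_ge1. Qed.
Let kc_gt0 (k : nat) : 0 < k%:R + c. Proof. by rewrite ltr_wpDl. Qed.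

Lemma tau_gt0 k : 0 < t k.
Proof. by rewrite divr_gt0. Qed.

Lemma tauV k : (t k)^-1 = (k%:R + c) / c.
Proof. by rewrite /tau invf_div. Qed.

Lemma tau_le1 k : t k <= 1.
Proof. by rewrite /tau ler_pdivrMr// mul1r lerDr. Qed.

Lemma tau0 : t 0 = 1.
Proof. by rewrite /tau add0r divff// gt_eqF. Qed.

Lemma tau_anti k : t k.+1 <= t k.
Proof.
by rewrite /tau ler_pM2l// lef_pV2 ?posrE// lerD2r ler_nat.
Qed.

Lemma dual_step_gt0 : 0 < dual_step.
Proof. by case/andP: gamma01 => _ g1; rewrite mulr_gt0 ?subr_gt0. Qed.

Lemma primal_weight_ge0 k : 0 <= primal_weight k.
Proof.
case/andP: gamma01 => g0 _; have [L0 _ _] := psi_smooth.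
have tk := ltW (tau_gt0 k); have g0' := ltW g0; have r0' := ltW rho0_gt0.
apply: divr_ge0 => //; apply: addr_ge0; apply: mulr_ge0 => //.
- exact: sqr_ge0.
- exact: mulr_ge0.
Qed.

Lemma primal_weight_anti k : primal_weight k.+1 <= primal_weight k.
Proof.
case/andP: gamma01 => g0 _; have [L0 _ _] := psi_smooth.
rewrite /primal_weight ler_pM2r ?invr_gt0// lerD2l ler_wpM2l ?tau_anti//.
by rewrite mulr_ge0// ltW.
Qed.

Lemma potential_ge0 k u v : 0 <= potential k u v.
Proof.
have e0 := ltW dual_step_gt0; have w0 := primal_weight_ge0 k.
by apply: addr_ge0; apply: mulr_ge0; rewrite ?sqr_ge0// ?invr_ge0; lra.
Qed.

Lemma psi_dom u : effdom psi u.
Proof. exact: smooth_domT psi_smooth. Qed.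

Lemma beta_gt0 k : 0 < beta K L rho0 c gamma k.
Proof.
case/andP: gamma01 => g0 _; have [L0 _ _] := psi_smooth.
have r0 : 0 < rho rho0 c k by rewrite divr_gt0//; exact: tau_gt0.
rewrite divr_gt0//; case: step_defined => h.
  apply: ltr_pwDl; last by rewrite mulr_ge0// ltW.
  by rewrite mulr_gt0// exprn_gt0// opnorm_gt0.
apply: ltr_wpDl; last exact: mulr_gt0.
by rewrite mulr_ge0 ?sqr_ge0// ltW.
Qed.

Lemma x_dom k : effdom f (x k.+1).
Proof.
have := scheme_x generated k.
by move/(prox_subgradient f_proper f_convex (beta_gt0 k)) => [].
Qed.

Lemma xhatE k : xhat k = (1 - t k) *: x k + t k *: xtil k.
Proof.
case: k => [|k].
  by rewrite tau0 subrr scale0r add0r scale1r /= (scheme_x0 generated)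
    (scheme_xhat0 generated).
rewrite (scheme_xhat generated) /=.
by apply/colP => i; rewrite !mxE; field; rewrite gt_eqF// tau_gt0.
Qed.

Lemma xE k : x k.+1 = (1 - t k) *: x k + t k *: xtil k.+1.
Proof.
by rewrite /=; apply/colP => i; rewrite !mxE; field; rewrite gt_eqF// tau_gt0.
Qed.

Lemma ytilE k : ytil k.+1 = ytil k + dual_step *: (K *m xtil k.+1 - b).
Proof.
rewrite (scheme_ytil generated); congr (_ + _).
have -> : K *m (x k.+1 - (1 - t k) *: x k) - t k *: b
    = t k *: (K *m xtil k.+1 - b).
  rewrite scalerBr scalemxAr /= scalerA divff ?scale1r//.
  by rewrite gt_eqF// tau_gt0.
rewrite scalerA /Defs.eta /Defs.rho /dual_step; congr (_ *: _).
by field; rewrite gt_eqF// tau_gt0.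
Qed.

Lemma combination_dom k u : effdom f u ->
  effdom f ((1 - t k) *: x k + t k *: u) /\
  objR ((1 - t k) *: x k + t k *: u) <= (1 - t k) * objR (x k) + t k * objR u.
Proof.
move=> du; case: k => [|k].
  by rewrite tau0 subrr scale0r add0r scale1r mul0r add0r mul1r.
have t01 : 0 <= 1 - t k.+1 <= 1.
  by rewrite subr_ge0 tau_le1 lerBlDl lerDr ltW// tau_gt0.
have [df lef] := convex_fine f_proper f_convex (x_dom k) du t01.
have [_ lep] := convex_fine psi_proper psi_convex (psi_dom (x k.+1)) (psi_dom u) t01.
move: df lef lep => /=; rewrite subKr => df lef lep.
by split => //; rewrite /objR; lra.
Qed.

(** This is [primal_dual_step] divided by [tau c k]: in this normalisation the
    weights of the squared distances are nonincreasing, and the penalty becomes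
    the square of a multiple of the residual, with the same multiple as the
    Lagrangian term. At k = 0 the terms in [x 0], a point possibly outside the
    domain of [f], carry the factor 0. *)
Lemma scheme_step k u v : effdom f u ->
  (k%:R + c) / c * lagrangian (x k.+1) v
  + rho0 / 2 * ((k%:R + c) / c * enorm (K *m x k.+1 - b)) ^+ 2
  + potential k.+1 u v
  <= k%:R / c * lagrangian (x k) v
  + rho0 / 2 * (k%:R / c * enorm (K *m x k - b)) ^+ 2
  + potential k u v + lagrangian u (y k.+1).
Proof.
move=> du; have tk0 := tau_gt0 k; have /andP[g0 g1] := gamma01.
have tk0n := lt0r_neq0 tk0.
have [G [GE Gle Glip]] := smooth_gradientP psi_proper psi_convex psi_smooth.
have [dz Fz] := combination_dom k du.
have := scheme_x generated k; rewrite -GE.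
move=> /(prox_subgradient f_proper f_convex (beta_gt0 k))[_ /(_ _ dz)].
have := @descent _ _ (fun w => fine (psi w)) G L (xhat k) (x k.+1)
  (fun u v => Gle u v (psi_dom u) (psi_dom v))
  (fun u v => Glip u v (psi_dom u) (psi_dom v)).
have := Gle (xhat k) ((1 - t k) *: x k + t k *: u) (psi_dom _) (psi_dom _).
have yE := scheme_y generated k.
set B := opnorm K ^+ 2 * (rho0 / t k) / gamma + L.
have bV : (beta K L rho0 c gamma k)^-1 = B.
  rewrite /beta invf_div /B /rho; field.
  by rewrite (gt_eqF g0) tk0n.
have r0 : 0 < rho0 / t k by rewrite divr_gt0.
have ebE : dual_step = (1 - gamma) * (rho0 / t k) * t k.
  by rewrite -mulrA divfK.
have := @primal_dual_step R p n K b (x k) (xtil k) (xtil k.+1) u (ytil k) v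
  gamma (rho0 / t k) (t k) dual_step L (objR (x k)) (objR u) (objR (x k.+1))
  gamma01 r0 tk0 ebE.
rewrite /= -xE -xhatE -/(rho rho0 c k) -yE -/B -ytilE.
set z := (1 - t k) *: x k + t k *: u; set w := xhat k.
move=> step psi1 psi2 f1.
have {step} := step _; rewrite -/(objR _).
(* The proximal, descent and convexity inequalities, added up. *)
have -> : objR (x k.+1) <= (1 - t k) * objR (x k) + t k * objR u +
    B * dot (w - x k.+1) (x k.+1 - z) - dot (y k.+1) (K *m (x k.+1 - z)) +
    L / 2 * enorm (x k.+1 - w) ^+ 2.
  apply: le_trans (_ : _ <= objR z + B * dot (w - x k.+1) (x k.+1 - z)
    - dot (y k.+1) (K *m (x k.+1 - z)) + L / 2 * enorm (x k.+1 - w) ^+ 2) _.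
    have bn := lt0r_neq0 (beta_gt0 k); move: f1 psi1 psi2.
    rewrite -dot_trmul bV -bV; set be := beta _ _ _ _ _ _ in bn *.
    have -> : w - be *: (K^T *m y k.+1 + G w) - x k.+1
        = w - x k.+1 - be *: (K^T *m y k.+1 + G w) by rewrite addrAC.
    have -> : x k.+1 - w = x k.+1 - z + (z - w) by rewrite addrA subrK.
    rewrite -[z - x k.+1]opprB /objR dotNr.
    rewrite (dotDl (w - _) (- _)) dotNl dotZl.
    have E A : be^-1 * - (A - be * dot (K^T *m y k.+1 + G w) (x k.+1 - z))
      = - (be^-1 * A) + dot (K^T *m y k.+1) (x k.+1 - z) + dot (G w) (x k.+1 - z).
      by rewrite (dotDl (K^T *m _)); field.
    rewrite E (dotDr (x k.+1 - z) (z - w) (G w)).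
    by lra.
  by move: Fz; rewrite -/z; lra.
move=> /(_ isT) main.
rewrite -tauV.
have tVge : 0 <= (t k)^-1 by rewrite invr_ge0 ltW.
have := ler_wpM2l tVge main; rewrite /lagrangian.
have kcE : k%:R / c = (t k)^-1 - 1.
  by rewrite tauV; field; rewrite gt_eqF.
have e5 N : (t k)^-1 * (t k ^+ 2 * B / 2 * N) = primal_weight k / 2 * N.
  by rewrite /B /primal_weight; field; rewrite (gt_eqF g0) tk0n.
have pw_le : primal_weight k.+1 / 2 * enorm (xtil k.+1 - u) ^+ 2 <=
    primal_weight k / 2 * enorm (xtil k.+1 - u) ^+ 2.
  by rewrite ler_wpM2r ?sqr_ge0// ler_pM2r ?primal_weight_anti.
have ebn := lt0r_neq0 dual_step_gt0.
have e6 N : (t k)^-1 * (t k / (2 * dual_step) * N) = (2 * dual_step)^-1 * N.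
  by field; rewrite tk0n ebn.
have e1 : (t k)^-1 * (rho0 / t k / 2 * enorm (K *m x k.+1 - b) ^+ 2)
   = rho0 / 2 * ((t k)^-1 * enorm (K *m x k.+1 - b)) ^+ 2 by field.
have e2 : (t k)^-1 * (rho0 / t k * (1 - t k) ^+ 2 / 2 * enorm (K *m x k - b) ^+ 2)
   = rho0 / 2 * (((t k)^-1 - 1) * enorm (K *m x k - b)) ^+ 2 by field.
have e3 : (t k)^-1 * ((1 - t k) * (objR (x k) + dot v (K *m x k - b)))
   = ((t k)^-1 - 1) * (objR (x k) + dot v (K *m x k - b)) by field.
have e4 : (t k)^-1 * (t k * (objR u + dot (y k.+1) (K *m u - b)))
   = objR u + dot (y k.+1) (K *m u - b) by field.
rewrite !(mulrDr (t k)^-1) e1 e2 e3 e4 e5 e6 kcE /potential.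
by move: pw_le; lra.
Qed.

Lemma lagrangian_feasible u v : K *m u = b -> lagrangian u v = objR u.
Proof. by move=> Ku; rewrite /lagrangian Ku subrr dot0r addr0. Qed.

(** For c = 1 the weights [k / c] and [(k - 1 + c) / c] agree, so the descent
    inequality telescopes; the averages [ybar k] are those for which the
    accumulated dual terms collapse to one. *)
Lemma ergodic_gap k u v : c = 1 -> effdom f u ->
  k%:R * (lagrangian (x k) v - lagrangian u (ybar k))
  + rho0 / 2 * (k%:R * enorm (K *m x k - b)) ^+ 2 + potential k u v
  <= potential 0 u v.
Proof.
move=> c1 du; elim: k => [|k IHk].
  by rewrite !mul0r expr0n mulr0 !add0r.
have := scheme_step k v du; rewrite c1 !divr1 natr1 => step.
have k0 : k.+1%:R != 0 :> R by rewrite pnatr_eq0.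
have tE : t k = k.+1%:R^-1 by rewrite /tau c1 natr1 div1r.
have ybarE : k.+1%:R * lagrangian u (ybar k.+1)
    = k%:R * lagrangian u (ybar k) + lagrangian u (y k.+1).
  rewrite (scheme_ybar generated) tE /lagrangian dotDl !dotZl.
  by move: k0; rewrite -natr1 => k0; field.
by rewrite mulrBr ybarE; lra.
Qed.

End Iterates.

(** * From the descent inequality to rates *)

Section Rates.
Variable R : realType.

(** Testing a bound that holds for every multiplier with one aligned with the
    residual turns it into a bound on the residual itself. The length
    [2 * |ys| + 1] leaves a margin over the [|ys|] that the saddle point
    inequality costs. *)
Lemma gap_to_residual n (a ys y0 : 'cV[R]_n) (D A B k : R) :
  0 <= B -> 0 < k ->
  (forall v, D + dot v a <= (A + B * enorm (y0 - v) ^+ 2) / (2 * k)) ->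
  0 <= D + dot ys a ->
  let Q := (A + B * (2 * enorm ys + enorm y0 + 1) ^+ 2) / (2 * k) in
  `|D| <= Q /\ enorm a <= Q.
Proof.
move=> B0 k0 gap D0 Q.
set s := enorm ys; have s0 : 0 <= s := enorm_ge0 _.
have [v va vn] : exists2 v, dot v a = (2 * s + 1) * enorm a & enorm v <= 2 * s + 1.
  have [a0|a0] := eqVneq (enorm a) 0.
    by exists 0; rewrite ?dot0l ?a0 ?mulr0 ?enorm0//; lra.
  exists (((2 * s + 1) / enorm a) *: a).
    by rewrite dotZl -enorm_sqr; field.
  rewrite enormZ ger0_norm ?divr_ge0 ?enorm_ge0//; last by lra.
  by rewrite divfK.
have DQ : D + (2 * s + 1) * enorm a <= Q.
  rewrite -va; apply: le_trans (gap v) _.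
  rewrite ler_pM2r ?invr_gt0 ?mulr_gt0// lerD2l ler_wpM2l//.
  rewrite ler_pXn2r ?nnegrE ?enorm_ge0//; last first.
    by rewrite !addr_ge0 ?mulr_ge0 ?enorm_ge0.
  have := enormD y0 (- v); rewrite enormN => /le_trans; apply.
  by move: vn; rewrite /s; lra.
have lo := cauchy_schwarz ys a; rewrite -/s in lo.
have N0 := enorm_ge0 a.
have sN : 0 <= s * enorm a by rewrite mulr_ge0.
by split; rewrite ?ler_norml; lra.
Qed.

(** The potential at rank k + 1 uses the weight [(k + c) / c] and the next step
    only [(k + 1) / c]. Since c > 1, each step leaves a surplus proportional to
    [D] and to k times the square of [N], and these surpluses sum up. *)
Lemma descent_rates (c r : R) (D N P : nat -> R) : 1 < c -> 0 < r ->
  (forall k, 0 <= D k.+1) -> (forall k, 0 <= N k) -> (forall k, 0 <= P k) ->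
  (forall k, (k%:R + c) / c * D k.+1 + r / 2 * ((k%:R + c) / c * N k.+1) ^+ 2
             + P k.+1
          <= k%:R / c * D k + r / 2 * (k%:R / c * N k) ^+ 2 + P k) ->
  exists C : R, [/\ 0 <= C,
    forall k, D k.+1 <= C / k.+1%:R,
    forall k, N k.+1 <= C / k.+1%:R &
    forall m, \sum_(0 <= k < m) (D k.+1 + k.+1%:R * N k.+1 ^+ 2) <= C].
Proof.
move=> c1 r0 D0 N0 P0 step; have c0 : 0 < c by lra.
have cn := lt0r_neq0 c0.
pose E k := (k%:R + c) / c * D k.+1 + r / 2 * ((k%:R + c) / c * N k.+1) ^+ 2
            + P k.+1.
pose kap := Num.min ((c - 1) / c) (r * (c - 1) / c ^+ 2).
have kap0 : 0 < kap.
  by rewrite lt_min !divr_gt0 ?mulr_gt0 ?exprn_gt0 ?subr_gt0.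
have kap1 : kap <= (c - 1) / c by rewrite ge_min lexx.
have kap2 : kap <= r * (c - 1) / c ^+ 2 by rewrite ge_min lexx orbT.
have E0 k : 0 <= E k.
  by rewrite !addr_ge0 ?mulr_ge0 ?sqr_ge0 ?invr_ge0 ?addr_ge0 ?N0// ltW.
have dec k : E k.+1 + kap * (D k.+1 + k.+1%:R * N k.+1 ^+ 2) <= E k.
  have := step k.+1; rewrite /E; set E' := _ + _ + P k.+2.
  move/(lerD (lexx (kap * (D k.+1 + k.+1%:R * N k.+1 ^+ 2)))).
  rewrite addrC => /le_trans; apply; rewrite -[k.+1%:R]natr1.
  have h1 : kap * D k.+1 <= (c - 1) / c * D k.+1 by rewrite ler_wpM2r.
  have h2 : kap * ((k%:R + 1) * N k.+1 ^+ 2) <=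
      r * (c - 1) / c ^+ 2 * ((k%:R + 1) * N k.+1 ^+ 2).
    by rewrite ler_wpM2r// mulr_ge0 ?sqr_ge0 ?addr_ge0.
  have h3 : 0 <= r / 2 * ((c - 1) / c * N k.+1) ^+ 2.
    by rewrite mulr_ge0 ?sqr_ge0// divr_ge0// ltW.
  have e1 : (k%:R + c) / c * D k.+1 = (k%:R + 1) / c * D k.+1 + (c - 1) / c * D k.+1.
    by field.
  have e2 : r / 2 * ((k%:R + c) / c * N k.+1) ^+ 2
      = r / 2 * ((k%:R + 1) / c * N k.+1) ^+ 2
      + r * (c - 1) / c ^+ 2 * ((k%:R + 1) * N k.+1 ^+ 2)
      + r / 2 * ((c - 1) / c * N k.+1) ^+ 2.
    by field.
  by rewrite e1 e2; lra.
have sum_le m : E m + kap * \sum_(0 <= k < m) (D k.+1 + k.+1%:R * N k.+1 ^+ 2)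
    <= E 0%N.
  elim: m => [|m IH]; first by rewrite big_nil mulr0 addr0.
  by rewrite big_nat_recr//= mulrDr; have := dec m; lra.
have S0 m : 0 <= \sum_(0 <= k < m) (D k.+1 + k.+1%:R * N k.+1 ^+ 2).
  by rewrite big_nat sumr_ge0// => k _; rewrite addr_ge0 ?mulr_ge0 ?sqr_ge0.
have E_le m : E m <= E 0%N.
  apply: le_trans (sum_le m); rewrite lerDl mulr_ge0//; exact: ltW.
have part1 k : (k%:R + c) / c * D k.+1 <= E 0%N.
  apply: le_trans (E_le k); rewrite /E -addrA lerDl addr_ge0//.
  by rewrite mulr_ge0 ?sqr_ge0// divr_ge0// ltW.
have part2 k : r / 2 * ((k%:R + c) / c * N k.+1) ^+ 2 <= E 0%N.
  apply: le_trans (E_le k); rewrite /E addrAC lerDr addr_ge0//.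
  by rewrite mulr_ge0// divr_ge0 ?addr_ge0// ltW.
pose C1 := c * E 0%N; pose C2 := c * Num.sqrt (2 / r * E 0%N).
pose C3 := E 0%N / kap.
have C10 : 0 <= C1 by rewrite mulr_ge0 ?E0// ltW.
have C20 : 0 <= C2 by rewrite mulr_ge0 ?sqrtr_ge0// ltW.
have C30 : 0 <= C3 by rewrite divr_ge0 ?E0// ltW.
have k1c k : k.+1%:R <= k%:R + c by rewrite -natr1 lerD2l ltW.
exists (C1 + C2 + C3); split.
- by rewrite !addr_ge0.
- move=> k; rewrite ler_pdivlMr//; apply: (@le_trans _ _ C1); last by lra.
  rewrite /C1 -ler_pdivrMl//; apply: le_trans (part1 k).
  have -> : (k%:R + c) / c * D k.+1 = c^-1 * (D k.+1 * (k%:R + c)) by ring.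
  by rewrite ler_pM2l ?invr_gt0// ler_wpM2l.
- move=> k; rewrite ler_pdivlMr//; apply: (@le_trans _ _ C2); last by lra.
  rewrite /C2 -ler_pdivrMl//; apply: (@le_trans _ _ ((k%:R + c) / c * N k.+1)).
    have -> : (k%:R + c) / c * N k.+1 = c^-1 * (N k.+1 * (k%:R + c)) by ring.
    by rewrite ler_pM2l ?invr_gt0// ler_wpM2l.
  have X0 : 0 <= (k%:R + c) / c * N k.+1.
    by rewrite mulr_ge0// divr_ge0 ?addr_ge0// ltW.
  rewrite -[leLHS]ger0_norm// -sqrtr_sqr ler_wsqrtr//.
  rewrite -ler_pdivrMl ?divr_gt0// invf_div; exact: part2.
- move=> m; apply: (@le_trans _ _ C3); last by lra.
  rewrite /C3 ler_pdivlMr// mulrC; apply: le_trans (sum_le m).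
  by rewrite lerDr.
Qed.

(** [1 / (x ln x)] is the derivative of [ln (ln x)]; two uses of
    [ln z <= z - 1] give the discrete comparison, by which the series of
    [1 / (k ln k)] diverges. *)
Lemma ln_ln_step (k : nat) : (2 <= k)%N ->
  ln (ln k.+1%:R) - ln (ln k%:R) <= (k%:R * ln k%:R)^-1 :> R.
Proof.
move=> k2; have k0 : 0 < k%:R :> R by rewrite ltr0n; apply: ltn_trans k2.
have k1 : 1 < k%:R :> R by rewrite ltr1n.
have l0 : 0 < ln (k%:R : R) by rewrite ln_gt0.
have l1 : 0 < ln (k.+1%:R : R) by rewrite ln_gt0// ltr1n; apply: leq_trans k2 _.
have le_ln (z : R) : 0 < z -> ln z <= z - 1.
  by move=> z0; rewrite -{1}(subrKC 1 z); apply: le_ln1Dx; lra.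
rewrite -ln_div ?posrE//; apply: le_trans (le_ln _ (divr_gt0 l1 l0)) _.
have -> : ln k.+1%:R / ln k%:R - 1 = (ln k.+1%:R - ln k%:R) / ln k%:R :> R.
  by field; rewrite gt_eqF.
rewrite invfM ler_pM2r ?invr_gt0// -ln_div ?posrE//.
apply: le_trans (le_ln _ (divr_gt0 _ k0)) _ => //.
by rewrite -natr1 le_eqVlt; apply/orP; left; apply/eqP; field; rewrite gt_eqF.
Qed.

Lemma ln_ln_unbounded (C : R) (m : nat) : exists2 k, (m <= k)%N & C < ln (ln k%:R).
Proof.
pose z := expR (expR (C + 1)).
exists (maxn m (Num.truncn z).+1); first exact: leq_maxl.
have zk : z < (maxn m (Num.truncn z).+1)%:R.
  by apply: lt_le_trans (truncnS_gt z) _; rewrite ler_nat leq_maxr.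
have z0 : 0 < z := expR_gt0 _.
apply: (@lt_le_trans _ _ (C + 1)); first by lra.
rewrite -[leLHS]expRK -[X in ln X]expRK -/z.
have lz : 0 < ln z by rewrite /z expRK expR_gt0.
have lzk : ln z < ln (maxn m (Num.truncn z).+1)%:R.
  by rewrite ltr_ln ?posrE//; apply: lt_trans zk.
by apply: ltW; rewrite ltr_ln ?posrE//; apply: lt_trans lzk.
Qed.

(** If the quantity stayed above [e / (k sqrt (ln k))] from some rank on, then
    the sum of [k (D k + Y N k)^2] would dominate that of [1 / (k ln k)], which
    diverges; but it converges, because [D k = O(1/k)] makes [k (D k)^2]
    comparable with [D k]. *)
Lemma log_improvement (C Y : R) (D N : nat -> R) : 0 <= C -> 0 <= Y ->
  (forall k, 0 <= D k.+1) -> (forall k, 0 <= N k) ->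
  (forall k, D k.+1 <= C / k.+1%:R) ->
  (forall m, \sum_(0 <= k < m) (D k.+1 + k.+1%:R * N k.+1 ^+ 2) <= C) ->
  forall (e : R) (m : nat), 0 < e -> exists2 k, (m <= k)%N &
    k.+1%:R * Num.sqrt (ln k.+1%:R) * (D k.+1 + Y * N k.+1) < e.
Proof.
move=> C0 Y0 D0 N0 DC sumC e m e0; apply: contrapT => h.
have big k : (m <= k)%N ->
    e <= k.+1%:R * Num.sqrt (ln k.+1%:R) * (D k.+1 + Y * N k.+1).
  by move=> mk; rewrite leNgt; apply/negP => lt; apply: h; exists k.
pose c2 := 2 * C + 2 * Y ^+ 2.
have c20 : 0 <= c2 by rewrite addr_ge0 ?mulr_ge0 ?sqr_ge0.
pose S k := D k.+1 + k.+1%:R * N k.+1 ^+ 2.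
have S0 k : 0 <= S k by rewrite addr_ge0 ?mulr_ge0 ?sqr_ge0.
have key k : (maxn m 1 <= k)%N ->
    e ^+ 2 * (ln (ln k.+2%:R) - ln (ln k.+1%:R)) <= c2 * S k.
  rewrite geq_max => /andP[mk k1].
  have kp : 0 < k.+1%:R :> R by [].
  have l0 : 0 < ln (k.+1%:R : R) by rewrite ln_gt0// ltr1n.
  apply: (@le_trans _ _ (e ^+ 2 * (k.+1%:R * ln k.+1%:R)^-1)).
    by rewrite ler_pM2l ?exprn_gt0// ln_ln_step.
  rewrite ler_pdivrMr ?mulr_gt0//.
  have := big _ mk; rewrite -(@ler_pXn2r _ 2) ?nnegrE ?(ltW e0)//; last first.
    by rewrite !mulr_ge0 ?sqrtr_ge0 ?addr_ge0 ?mulr_ge0.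
  move=> /le_trans; apply; rewrite !exprMn sqr_sqrtr ?(ltW l0)//.
  have -> : k.+1%:R ^+ 2 * ln k.+1%:R * (D k.+1 + Y * N k.+1) ^+ 2
    = k.+1%:R * (D k.+1 + Y * N k.+1) ^+ 2 * (k.+1%:R * ln k.+1%:R) by ring.
  rewrite ler_wpM2r ?mulr_ge0 ?(ltW l0)//.
  have kD : k.+1%:R * D k.+1 <= C by rewrite mulrC -ler_pdivlMr.
  have kDD : k.+1%:R * D k.+1 ^+ 2 <= C * D k.+1.
    by rewrite expr2 mulrA ler_wpM2r.
  have sq : 0 <= k.+1%:R * (D k.+1 - Y * N k.+1) ^+ 2.
    by rewrite mulr_ge0 ?sqr_ge0.
  have h1 : 0 <= Y ^+ 2 * D k.+1 by rewrite mulr_ge0 ?sqr_ge0.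
  have h2 : 0 <= C * (k.+1%:R * N k.+1 ^+ 2) by rewrite !mulr_ge0 ?sqr_ge0.
  by rewrite /c2 /S; lra.
set M := maxn m 1.
have tele n : (M <= n)%N ->
    e ^+ 2 * (ln (ln n.+1%:R) - ln (ln M.+1%:R)) <= c2 * \sum_(M <= k < n) S k.
  move=> Mn; have <- := telescope_sumr (fun k => ln (ln (k.+1%:R : R))) Mn.
  rewrite !mulr_sumr big_nat [leRHS]big_nat ler_sum// => k /andP[Mk _].
  exact: key.
have [n Mn] := ln_ln_unbounded (c2 * C / e ^+ 2 + ln (ln M.+1%:R)) M.+1.
case: n Mn => // n; rewrite ltnS => Mn; rewrite -ltrBrDr ltr_pdivrMr ?exprn_gt0//.
apply/negP; rewrite -leNgt mulrC; apply: le_trans (tele _ Mn) _.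
rewrite ler_wpM2l//; apply: le_trans (sumC n).
rewrite [leRHS](@big_cat_nat _ _ _ M)//= lerDr big_nat; apply: sumr_ge0 => k _.
exact: S0.
Qed.

End Rates.

Lemma limn_einf_eq0 (R : realType) (u : nat -> \bar R) :
  (forall k, 0 <= u k)%E ->
  (forall (e : R) m, 0 < e -> exists2 k, (m <= k)%N & (u k <= e%:E)%E) ->
  limn_einf u = 0%E.
Proof.
move=> u0 small; rewrite limn_einf_lim.
have -> : einfs u = cst 0%E.
  apply/funext => m; apply/eqP; rewrite eq_le; apply/andP; split; last first.
    by apply: le_ereal_inf_tmp => _ [k _ <-].
  apply/lee_addgt0Pr => e e0; rewrite add0e; have [k mk uk] := small e m e0.
  by apply: le_trans uk; apply: ereal_inf_lbound; exists k.
exact: lim_cst.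
Qed.

(** * Convergence rates *)

Theorem corollary3p7 (R : realType) (p n : nat)
    (f psi : 'cV[R]_p -> \bar R) (K : 'M[R]_(n, p)) (b : 'cV[R]_n)
    (L rho0 c gamma : R)
    (xs x0 : 'cV[R]_p) (ys y0 : 'cV[R]_n)
    (x xhat : nat -> 'cV[R]_p) (y ytil ybar : nat -> 'cV[R]_n)
    (f_proper : proper_fun f) (f_closed : closed_fun f) (f_convex : convex_fun f)
    (psi_proper : proper_fun psi) (psi_closed : closed_fun psi)
    (psi_convex : convex_fun psi)
    (sol_nonempty : primal_sol f psi K b !=set0)
    (qualification : ri (effdom f `&` effdom psi) `&` feasible K b !=set0)
    (psi_smooth : smooth L psi)
    (xs_sol : primal_sol f psi K b xs) (ys_sol : dual_sol f psi K b ys)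
    (rho0_gt0 : 0 < rho0) (c_ge1 : 1 <= c) (gamma01 : 0 < gamma < 1)
    (* otherwise every denominator in [beta] vanishes *)
    (step_defined : K != 0 \/ 0 < L)
    (generated :
       scheme f psi K b L rho0 c gamma x0 y0 x xhat y ytil ybar) :
  let F := objF f psi in
  let Fs := Fstar f psi K b in
  let G := dualG f psi K b in
  let Gs := Gstar f psi K b in
  let R02 := R0sq K L rho0 gamma x0 xs y0 ys in
  let DF := D_F f psi x0 in
  (c = 1 ->
     (forall k : nat, (1 <= k)%N ->
        (`|F (x k) - Fs| <= (R02 / (2 * k%:R))%:E)%E /\
        enorm (K *m x k - b) <= R02 / (2 * k%:R)) /\
     (ebounded (effdom F) ->
        (DF < +oo)%E /\
        forall k : nat, (1 <= k)%N ->
          (G (ybar k) - Gs <=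
             ((2 * k%:R)^-1)%:E *
               (((rho0 * opnorm K ^+ 2 + gamma * L) / gamma)%:E * (DF * DF)
                + (enorm (y0 - ys) ^+ 2 / ((1 - gamma) * rho0))%:E))%E)) /\
  (1 < c ->
     [/\ bigO_inv (fun k => F (x k) - Fs)%E,
         bigO_inv (fun k => (enorm (K *m x k - b))%:E) &
         limn_einf (fun k : nat =>
           ((k%:R * Num.sqrt (ln k%:R))%:E *
             (`|F (x k) - Fs| + (enorm (K *m x k - b))%:E))%E) = 0%E]).
Proof.
move=> F Fs G Gs R02 DF.
have [xb [ri_xb Kxb]] := qualification.
have [[fxs pxs] GsE saddle] := strong_duality f_proper psi_proper f_convex
  psi_convex ri_xb Kxb xs_sol ys_sol.
have [Kxs FxsE] := xs_sol.
set Fr := fine (f xs) + fine (psi xs) in GsE saddle.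
have FsE : Fs = Fr%:E by rewrite /Fs -FxsE objFE.
have [L0 _ _] := psi_smooth; have /andP[g0 g1] := gamma01.
have pd u : effdom psi u := psi_dom psi_proper psi_closed psi_convex psi_smooth u.
have xd k : effdom f (x k.+1).
  exact: (x_dom f_proper f_convex psi_smooth rho0_gt0 c_ge1 gamma01
    step_defined generated).
have FE k : F (x k.+1) = (objR f psi (x k.+1))%:E by rewrite /F objFE.
pose gap k v := lagrangian f psi K b (x k) v - Fr.
have gapE k v : gap k v = objR f psi (x k) - Fr + dot v (K *m x k - b).
  by rewrite /gap /lagrangian addrAC.
have gap_ge0 k : 0 <= gap k.+1 ys.
  by rewrite subr_ge0; apply: saddle.
have lag_xs v : lagrangian f psi K b xs v = Fr by rewrite lagrangian_feasible.
set W := (rho0 * opnorm K ^+ 2 + gamma * L) / gamma.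
set V := ((1 - gamma) * rho0)^-1.
have V0 : 0 < V by rewrite invr_gt0 mulr_gt0 ?subr_gt0.
have W0 : 0 <= W.
  apply: divr_ge0; last exact: ltW.
  by apply: addr_ge0; apply: mulr_ge0; rewrite ?sqr_ge0//; apply: ltW.
have pot0 u v : potential K L rho0 c gamma x ytil 0 u v
    = (W * enorm (x0 - u) ^+ 2 + V * enorm (y0 - v) ^+ 2) / 2.
  rewrite /potential /= (scheme_x0 generated) (scheme_ytil0 generated).
  rewrite /primal_weight (tau0 c_ge1) /W /V /dual_step; field.
  by rewrite !gt_eqF ?subr_gt0.
have pot_ge0 := potential_ge0 K x ytil psi_smooth rho0_gt0 c_ge1 gamma01.
have erg := ergodic_gap f_proper f_convex psi_proper psi_closed psi_convex
  psi_smooth rho0_gt0 c_ge1 gamma01 step_defined generated.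
split=> [c1|c1].
  split=> [[//|k] _|[M FM]].
    have k0 : 0 < k.+1%:R :> R by [].
    have gap_le v : gap k.+1 v
        <= (W * enorm (x0 - xs) ^+ 2 + V * enorm (y0 - v) ^+ 2) / (2 * k.+1%:R).
      have := erg k.+1 xs v c1 fxs; rewrite lag_xs pot0 -/(gap _ _) => le.
      rewrite invfM mulrA ler_pdivlMr// mulrC.
      have h1 := pot_ge0 k.+1 xs v.
      have h2 : 0 <= rho0 / 2 * (k.+1%:R * enorm (K *m x k.+1 - b)) ^+ 2.
        by rewrite mulr_ge0 ?sqr_ge0// divr_ge0// ltW.
      by move: le; lra.
    have [] := @gap_to_residual _ _ (K *m x k.+1 - b) ys y0
      (objR f psi (x k.+1) - Fr) (W * enorm (x0 - xs) ^+ 2) V k.+1%:R (ltW V0) k0.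
    - by move=> v; rewrite -gapE.
    - by rewrite -gapE.
    by move=> h1 h2; split => //; rewrite FE FsE -EFinB abse_EFin lee_fin.
  have dF u : effdom F u -> effdom f u /\ effdom psi u.
    by rewrite /F (effdom_objF f_proper psi_proper).
  have DFlt : (DF < +oo)%E.
    apply: (@le_lt_trans _ _ (M + enorm x0)%:E); last exact: ltry.
    apply: ge_ereal_sup => _ [u du <-]; rewrite lee_fin.
    by apply: le_trans (enormD _ _) _; rewrite enormN lerD2r FM.
  have DFge u : effdom f u -> ((enorm (u - x0))%:E <= DF)%E.
    move=> du; apply: ereal_sup_ubound; exists u => //=.
    by rewrite (effdom_objF f_proper psi_proper).
  split => // -[//|k] _.
  have [d DFE] : exists d, DF = d%:E.
    exists (fine DF); rewrite fineK// fin_numE -ltey DFlt andbT gt_eqF//.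
    exact: lt_le_trans (ltNyr _) (DFge _ fxs).
  rewrite {}DFE in DFge DFlt *.
  rewrite -EFinM [Gs]GsE -EFinN opprK.
  rewrite -leeBrDr// -EFinB.
  apply: (dualG_le f_proper psi_proper) => u fu pu.
  have k0 : 0 < k.+1%:R :> R by [].
  have := erg k.+1 u ys c1 fu; rewrite pot0 => le.
  have h1 := pot_ge0 k.+1 u ys.
  have h2 : 0 <= rho0 / 2 * (k.+1%:R * enorm (K *m x k.+1 - b)) ^+ 2.
    by rewrite mulr_ge0 ?sqr_ge0// divr_ge0// ltW.
  have h3 : W * enorm (x0 - u) ^+ 2 <= W * (d * d).
    rewrite ler_wpM2l// -expr2 ler_pXn2r ?nnegrE ?enorm_ge0//.
      by have := DFge _ fu; rewrite lee_fin enormBC.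
    by have := DFge _ fu; rewrite lee_fin => h; exact: le_trans (enorm_ge0 _) h.
  have h4 := gap_ge0 k.
  have h5 : k.+1%:R * gap k.+1 ys = k.+1%:R * (lagrangian f psi K b (x k.+1) ys - Fr).
    by [].
  have h6 : 0 <= k.+1%:R * gap k.+1 ys by rewrite mulr_ge0.
  have h7 : k.+1%:R * (Fr - lagrangian f psi K b u (ybar k.+1)) <=
      (W * (d * d) + enorm (y0 - ys) ^+ 2 * V) / 2.
    by move: le h1 h2 h3 h4 h5 h6; rewrite /gap; lra.
  have h8 : Fr - lagrangian f psi K b u (ybar k.+1) <= (2 * k.+1%:R)^-1 *
      (W * (d * d) + enorm (y0 - ys) ^+ 2 * V).
    by rewrite invfM [2^-1 * _]mulrC -mulrA ler_pdivlMl// [2^-1 * _]mulrC.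
  by rewrite opprB lerBlDl -lerBlDr; exact: h8.
have c0 : 0 < c := lt_trans ltr01 c1.
pose N k := enorm (K *m x k - b).
have N0 k : 0 <= N k := enorm_ge0 _.
have [|C [C0 DC NC sumC]] := @descent_rates R c rho0 (gap^~ ys) N
    (fun k => potential K L rho0 c gamma x ytil k xs ys) c1 rho0_gt0 gap_ge0 N0
    (fun k => pot_ge0 k xs ys).
  move=> k; have := scheme_step f_proper f_convex psi_proper psi_closed
    psi_convex psi_smooth rho0_gt0 c_ge1 gamma01 step_defined generated k ys fxs.
  rewrite lag_xs /gap !mulrBr.
  have -> : (k%:R + c) / c * Fr = k%:R / c * Fr + Fr by field; rewrite gt_eqF.
  by rewrite -/(N k) -/(N k.+1); lra.
have s0 : 0 <= enorm ys := enorm_ge0 _.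
have F_le k : `|objR f psi (x k) - Fr| <= `|gap k ys| + enorm ys * N k.
  have -> : objR f psi (x k) - Fr = gap k ys - dot ys (K *m x k - b).
    by rewrite gapE addrK.
  apply: le_trans (ler_normB _ _) _; rewrite lerD2l ler_norml.
  by rewrite /N dot_enormN cauchy_schwarz.
have F_leS k : `|objR f psi (x k.+1) - Fr| <= gap k.+1 ys + enorm ys * N k.+1.
  by rewrite -(ger0_norm (gap_ge0 k)); exact: F_le.
split.
- exists (C + enorm ys * C); exists 1%N => // -[//|k] _.
  rewrite FE FsE -EFinB abse_EFin lee_fin; apply: le_trans (F_leS k) _.
  by rewrite mulrDl lerD// -mulrA ler_wpM2l.
- by exists C; exists 1%N => // -[//|k] _; rewrite abse_EFin lee_fin ger0_norm ?enorm_ge0 ?NC.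
apply: limn_einf_eq0 => [k|e m e0].
  apply: mule_ge0; first by rewrite lee_fin mulr_ge0 ?sqrtr_ge0.
  by apply: adde_ge0; [exact: abse_ge0|rewrite lee_fin enorm_ge0].
have [k mk lt] := @log_improvement R C (enorm ys + 1) (gap^~ ys) N C0
  (addr_ge0 s0 ler01) gap_ge0 N0 DC sumC e m e0.
exists k.+1; first exact: leqW.
rewrite FE FsE -EFinB abse_EFin -EFinD -EFinM lee_fin; apply: le_trans (ltW lt).
rewrite ler_wpM2l ?mulr_ge0 ?sqrtr_ge0//.
by have := F_leS k; rewrite -/(N k.+1); lra.
Qed.
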